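(* Let $\Bbbk$ be a field, $H$ a Hopf algebra over $\Bbbk$, $R$ a $\Bbbk$-algebra that is a right $H$-comodule algebra, $\sigma:R\to R$ an injective $\Bbbk$-algebra endomorphism that is a morphism of right $H$-comodules, and $A=R[x;\sigma]$ the skew polynomial ring of endomorphism type over $R$ (i.e. with zero derivation), equipped with the right $H$-comodule algebra structure $\rho_A\left(\sum_{i} r_ix^i\right)=\sum_{i}(r_i)_{(0)}x^i\otimes (r_i)_{(1)}$. If $R$ is a right $H$-Galois object, then $\Bbbk[x;\sigma]\subset A$ is a right $H$-Galois extension.
   Context: All rings and ring morphisms are unital; algebras are associative; unadorned tensor products are over $\Bbbk$. Skew polynomial rings of endomorphism type: for a ring $R$ and ring endomorphism $\sigma$, $R[x;\sigma]$ is a ring containing $R$ as a (proper) unital subring with a distinguished element $x$ such that it is a free left $R$-module with basis $\{1,x,x^2,\dots\}$ and $xr=\sigma(r)x$ for all $r\in R$. The notation $\Bbbk[x;\sigma]$ denotes the subalgebra of $A$ of all $\sum_i k_ix^i$ with $k_i\in\Bbbk$ ($\sigma$ being restricted to $\Bbbk=\Bbbk 1_R$). Comodule algebras: a right $H$-comodule is a $\Bbbk$-vector space $N$ with a $\Bbbk$-linear map $\rho:N\to N\otimes H$ such that $(\operatorname{id}_N\otimes\Delta)\rho=(\rho\otimes\operatorname{id}_H)\rho$ and $(\operatorname{id}_N\otimes\varepsilon)\rho(n)=n\otimes 1$; one writes $\rho(n)=n_{(0)}\otimes n_{(1)}$ (implicit summation). A $\Bbbk$-linear map $g:N\to L$ of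 right $H$-comodules is a comodule morphism if $\rho_L(g(n))=g(n_{(0)})\otimes n_{(1)}$ for all $n$. A right $H$-comodule algebra is an algebra $B$ that is a right $H$-comodule with $\rho(ab)=a_{(0)}b_{(0)}\otimes a_{(1)}b_{(1)}$ and $\rho(1_B)=1_B\otimes 1_H$. Its subalgebra of coinvariants is $B^{\operatorname{co}H}=\{b\in B:\rho(b)=b\otimes 1\}$. Galois extensions: for a right $H$-comodule algebra $B$, the extension $B^{\operatorname{co}H}\subset B$ is a right $H$-Galois extension if the map $\beta:B\otimes_{B^{\operatorname{co}H}}B\to B\otimes H$, $\beta(a\otimes b)=ab_{(0)}\otimes b_{(1)}$, is bijective. $B$ is a right $H$-Galois object if moreover $B^{\operatorname{co}H}=\Bbbk$. Thus the conclusion means that $A^{\operatorname{co}H}=\Bbbk[x;\sigma]$ and that $\beta:A\otimes_{\Bbbk[x;\sigma]}A\to A\otimes H$ is bijective. *)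

(* Defs.v *)
From HB Require Import structures.
From mathcomp Require Import all_boot all_algebra generic_quotient.
From mathcomp.multinomials Require Import freeg.
From mathcomp Require Import boolp classical_sets.

Set Implicit Arguments.
Unset Strict Implicit.
Unset Printing Implicit Defensive.

Import GRing.Theory.
Local Open Scope ring_scope.
Local Open Scope quotient_scope.

Section BalancedTensor.
Variables (C : Type) (M N : zmodType) (ract : M -> C -> M) (lact : C -> N -> N).

Inductive tens_relator : {freeg (M * N)} -> Prop :=
| TensDl m m' n : tens_relator (<< (m + m', n) >> - << (m, n) >> - << (m', n) >>)
| TensDr m n n' : tens_relator (<< (m, n + n') >> - << (m, n) >> - << (m, n') >>)
| TensBal m c n : tens_relator (<< (ract m c, n) >> - << (m, lact c n) >>).

(* The subgroup generated by the relators. *)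
Inductive tens_null : {freeg (M * N)} -> Prop :=
| TensNull0 : tens_null 0
| TensNullRel u : tens_relator u -> tens_null u
| TensNullB u v : tens_null u -> tens_null v -> tens_null (u - v).

Definition tens_nullb : {pred {freeg (M * N)}} := fun u => `[< tens_null u >].

Fact tens_nullb_zmod_closed : zmod_closed tens_nullb.
Proof.
split=> [|u v]; rewrite !unfold_in; first by apply/asboolP; exact: TensNull0.
by move=> /asboolP hu /asboolP hv; apply/asboolP; exact: TensNullB.
Qed.

HB.instance Definition _ :=
  GRing.isZmodClosed.Build {freeg (M * N)} tens_nullb tens_nullb_zmod_closed.

(* M and N are only abelian groups and C only a type of scalars acting on the
   right of M and on the left of N: when C is a ring and the actions are module
   structures, this is the usual abelian group M (x)_C N. *)
Definition tens := @Quotient.quot {freeg (M * N)} tens_nullb.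

HB.instance Definition _ := GRing.Zmodule.on tens.

Definition tens_class (u : {freeg (M * N)}) : tens := \pi_tens u.

Definition pure (m : M) (n : N) : tens := tens_class << (m, n) >>.

Lemma tens_classB u v : tens_class (u - v) = tens_class u - tens_class v.
Proof. exact: raddfB. Qed.

Lemma tens_class_eq u v : tens_class u = tens_class v <-> tens_null (u - v).
Proof.
have -> : tens_null (u - v) <-> Quotient.equiv tens_nullb u v.
  by split=> /asboolP.
by rewrite /tens_class; split=> [/eqmodP //|h]; apply/eqmodP.
Qed.

Lemma tens_class_repr t : tens_class (repr t) = t.
Proof. exact: reprK. Qed.

HB.instance Definition _ :=
  GRing.isZmodMorphism.Build {freeg (M * N)} tens tens_class tens_classB.

Lemma pureDl m m' n : pure (m + m') n = pure m n + pure m' n.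
Proof.
apply/eqP; rewrite -subr_eq0 opprD addrA /pure -!tens_classB; apply/eqP.
rewrite -[RHS](raddf0 tens_class); apply/tens_class_eq; rewrite subr0.
by apply: TensNullRel; exact: TensDl.
Qed.

Lemma pureDr m n n' : pure m (n + n') = pure m n + pure m n'.
Proof.
apply/eqP; rewrite -subr_eq0 opprD addrA /pure -!tens_classB; apply/eqP.
rewrite -[RHS](raddf0 tens_class); apply/tens_class_eq; rewrite subr0.
by apply: TensNullRel; exact: TensDr.
Qed.

Lemma pure_bal m c n : pure (ract m c) n = pure m (lact c n).
Proof. by apply/tens_class_eq/TensNullRel; exact: TensBal. Qed.

Lemma pure0l n : pure 0 n = 0.
Proof. by apply: (addIr (pure 0 n)); rewrite -pureDl !add0r. Qed.

Lemma pure0r m : pure m 0 = 0.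
Proof. by apply: (addIr (pure m 0)); rewrite -pureDr !add0r. Qed.

Lemma pureNl m n : pure (- m) n = - pure m n.
Proof. by apply/eqP; rewrite -addr_eq0 -pureDl addNr pure0l. Qed.

Lemma tens_ind (P : tens -> Prop) :
  (forall m n, P (pure m n)) -> (forall t u, P t -> P u -> P (t + u)) ->
  forall t, P t.
Proof.
move=> Pp PD; have P0 : P 0 by rewrite -(pure0l 0).
have PMn m n k : P (pure m n *+ k) by elim: k => // k IH; rewrite mulrS; apply: PD.
move=> t; rewrite -[t]tens_class_repr -[repr t]freeg_sumE raddf_sum /=.
elim: (dom _) => [|[m n] s IH]; first by rewrite big_nil.
rewrite big_cons; apply: PD => //; set k := coeff _ _.
rewrite -[k]mulr1 -[k]intz mulrzl -freeg_mulz raddfMz -/(pure m n).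
case: k => k; first exact: PMn.
by rewrite /intmul -mulNrn -pureNl; apply: PMn.
Qed.

Section Lift.
Variables (G : zmodType) (f : M -> N -> G).

Record balanced : Prop := Balanced {
  balancedDl m m' n : f (m + m') n = f m n + f m' n;
  balancedDr m n n' : f m (n + n') = f m n + f m n';
  balancedM m c n : f (ract m c) n = f m (lact c n) }.

(* Total version of the map M (x)_C N -> G induced by f: it is defined on a
   representative, and is the induced morphism as soon as f is balanced. *)
Definition tens_lift (t : tens) : G :=
  fglift (fun z => f z.1 z.2 : zmodule G) (repr t).

Hypothesis fP : balanced.

Let ev := fglift (fun z : M * N => f z.1 z.2 : zmodule G).

Let evB u v : ev (u - v) = ev u - ev v.
Proof. exact: lift_is_additive. Qed.

Let evU z : ev << z >> = f z.1 z.2.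
Proof. by rewrite /ev liftU scale1r. Qed.

Let ev_null u : tens_null u -> ev u = 0.
Proof.
elim=> [|{}u|{}u v _ hu _ hv]; last by rewrite evB hu hv subrr.
  by rewrite -[0](subrr 0) evB subrr.
case=> [m m' n|m n n'|m c n]; rewrite !evB !evU /=.
- by rewrite (balancedDl fP) -addrA -opprD subrr.
- by rewrite (balancedDr fP) -addrA -opprD subrr.
- by rewrite (balancedM fP) subrr.
Qed.

Let tens_lift_class u : tens_lift (tens_class u) = ev u.
Proof.
apply/eqP; rewrite -subr_eq0 -evB; apply/eqP/ev_null.
by apply/tens_class_eq; rewrite tens_class_repr.
Qed.

Lemma tens_lift_pure m n : tens_lift (pure m n) = f m n.
Proof. by rewrite tens_lift_class evU. Qed.

Lemma tens_liftB t u : tens_lift (t - u) = tens_lift t - tens_lift u.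
Proof.
rewrite -(tens_class_repr t) -(tens_class_repr u).
by rewrite -tens_classB !tens_lift_class evB.
Qed.

End Lift.
End BalancedTensor.

Reserved Notation "V ⊗ W" (at level 40, left associativity).
Reserved Notation "v \ox w" (at level 40, left associativity).

Section Tensor.
Variable k : fieldType.
Implicit Types U V W : lmodType k.

Definition tensor V W : Type :=
  tens (fun (v : V) (c : k) => c *: v) (fun (c : k) (w : W) => c *: w).

HB.instance Definition _ V W := GRing.Zmodule.on (tensor V W).

Local Notation "V ⊗ W" := (tensor V W) : type_scope.

Definition tmul V W (v : V) (w : W) : V ⊗ W := pure _ _ v w.

Local Notation "v \ox w" := (tmul v w) : ring_scope.

Definition tlift V W (G : zmodType) (f : V -> W -> G) : V ⊗ W -> G := tens_lift f.

Definition bilinear_map V W U (f : V -> W -> U) : Prop :=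
  (forall w, linear (f^~ w)) /\ (forall v, linear (f v)).

Lemma tmulDl V W (v v' : V) (w : W) : (v + v') \ox w = v \ox w + v' \ox w.
Proof. exact: pureDl. Qed.

Lemma tmulDr V W (v : V) (w w' : W) : v \ox (w + w') = v \ox w + v \ox w'.
Proof. exact: pureDr. Qed.

Lemma tmulZ V W c (v : V) (w : W) : (c *: v) \ox w = v \ox (c *: w).
Proof. exact: pure_bal. Qed.

Lemma tensor_ind V W (P : V ⊗ W -> Prop) :
  (forall v w, P (v \ox w)) -> (forall t u, P t -> P u -> P (t + u)) ->
  forall t, P t.
Proof. exact: tens_ind. Qed.

Section Scale.
Variables V W : lmodType k.

Definition tscale (c : k) : V ⊗ W -> V ⊗ W := tlift (fun v w => (c *: v) \ox w).

Lemma tscale_balanced c :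
  balanced (fun (v : V) (c : k) => c *: v) (fun (c : k) (w : W) => c *: w)
    (fun v w => (c *: v) \ox w).
Proof.
split=> [v v' w|v w w'|v d w]; first by rewrite scalerDr tmulDl.
  by rewrite tmulDr.
by rewrite scalerA mulrC -scalerA tmulZ.
Qed.

Lemma tscaleB c : zmod_morphism (tscale c).
Proof. by move=> t u; apply: tens_liftB; apply: tscale_balanced. Qed.

HB.instance Definition _ c :=
  GRing.isZmodMorphism.Build (V ⊗ W) (V ⊗ W) (tscale c) (tscaleB c).

Lemma tscaleE c v w : tscale c (v \ox w) = (c *: v) \ox w.
Proof. by apply: tens_lift_pure; apply: tscale_balanced. Qed.

Fact tscaleA a b t : tscale a (tscale b t) = tscale (a * b) t.
Proof.
elim/tensor_ind: t => [v w|t u ht hu]; first by rewrite !tscaleE scalerA.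
by rewrite !raddfD /= ht hu.
Qed.

Fact tscale1 : left_id 1 tscale.
Proof.
move=> t; elim/tensor_ind: t => [v w|t u ht hu]; first by rewrite tscaleE scale1r.
by rewrite raddfD /= ht hu.
Qed.

Fact tscaleDr : right_distributive tscale +%R.
Proof. by move=> c t u; apply: raddfD. Qed.

Fact tscaleDl t : {morph tscale^~ t : a b / a + b}.
Proof.
move=> a b; elim/tensor_ind: t => [v w|t u ht hu].
  by rewrite !tscaleE scalerDl tmulDl.
by rewrite !raddfD /= ht hu addrACA.
Qed.

HB.instance Definition _ :=
  GRing.Zmodule_isLmodule.Build k (V ⊗ W) tscaleA tscale1 tscaleDr tscaleDl.

Lemma scale_tmul c (v : V) (w : W) : c *: (v \ox w) = (c *: v) \ox w.
Proof. exact: tscaleE. Qed.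

Lemma tmul_linearl w : linear (fun v : V => v \ox w).
Proof. by move=> c v v'; rewrite tmulDl scale_tmul. Qed.

Lemma tmul_linearr (v : V) : linear (fun w : W => v \ox w).
Proof. by move=> c w w'; rewrite tmulDr scale_tmul tmulZ. Qed.

End Scale.

Section Lift.
Variables (V W U : lmodType k) (f : V -> W -> U).
Hypothesis fP : bilinear_map f.

Let fDl w : {morph f^~ w : v v' / v + v'}.
Proof. by move=> v v'; rewrite -[v in LHS]scale1r fP.1 scale1r. Qed.

Let fDr v : {morph f v : w w' / w + w'}.
Proof. by move=> w w'; rewrite -[w in LHS]scale1r fP.2 scale1r. Qed.

Let fZl c v w : f (c *: v) w = c *: f v w.
Proof.
have f0 : f 0 w = 0 by apply: (addIr (f 0 w)); rewrite -fDl !add0r.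
by rewrite -[c *: v]addr0 fP.1 f0 addr0.
Qed.

Let fZr c v w : f v (c *: w) = c *: f v w.
Proof.
have f0 : f v 0 = 0 by apply: (addIr (f v 0)); rewrite -fDr !add0r.
by rewrite -[c *: w]addr0 fP.2 f0 addr0.
Qed.

Lemma bilinear_balanced :
  balanced (fun (v : V) (c : k) => c *: v) (fun (c : k) (w : W) => c *: w) f.
Proof. by split=> *; rewrite ?fDl ?fDr ?fZl ?fZr. Qed.

Lemma tliftE v w : tlift f (v \ox w) = f v w.
Proof. exact: tens_lift_pure bilinear_balanced _ _. Qed.

Lemma tliftB : zmod_morphism (tlift f).
Proof. by move=> t u; apply: tens_liftB; apply: bilinear_balanced. Qed.

Lemma tlift_linear : linear (tlift f).
Proof.
pose g := HB.pack_for {additive (V ⊗ W)%type -> U} (tlift f)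
  (GRing.isZmodMorphism.Build _ _ _ tliftB).
have gE : tlift f = g by [].
move=> c t u; rewrite gE raddfD; congr (_ + _).
elim/tensor_ind: t => [v w|{}t {}u ht hu]; last first.
  by rewrite scalerDr !(raddfD g) ht hu scalerDr.
by rewrite scale_tmul -gE !tliftE fZl.
Qed.

End Lift.
End Tensor.

Notation "V ⊗ W" := (tensor V W) : type_scope.
Notation "v \ox w" := (tmul v w) : ring_scope.

Section TensorMaps.
Variable k : fieldType.
Implicit Types U V W : lmodType k.

Definition tmap V V' W W' (f : V -> V') (g : W -> W') : V ⊗ W -> V' ⊗ W' :=
  tlift (fun v w => f v \ox g w).

Lemma tmap_bilinear V V' W W' (f : {linear V -> V'}) (g : {linear W -> W'}) :
  bilinear_map (fun v w => f v \ox g w).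
Proof.
split=> [w c v v'|v c w w']; rewrite linearP.
  exact: (tmul_linearl (g w)).
exact: tmul_linearr.
Qed.

Lemma tmapE V V' W W' (f : {linear V -> V'}) (g : {linear W -> W'}) v w :
  tmap f g (v \ox w) = f v \ox g w.
Proof. exact: tliftE (tmap_bilinear f g) v w. Qed.

Definition tassoc U V W : (U ⊗ V) ⊗ W -> U ⊗ (V ⊗ W) :=
  tlift (fun t w => tlift (fun u v => u \ox (v \ox w)) t).

Lemma tassocE U V W (u : U) (v : V) (w : W) :
  tassoc ((u \ox v) \ox w) = u \ox (v \ox w).
Proof.
have inner (w' : W) : bilinear_map (fun (u : U) (v : V) => u \ox (v \ox w')).
  split=> [v' c u1 u2|u' c v1 v2]; first exact: (tmul_linearl (v' \ox w')).
  by rewrite (tmul_linearl w') (tmul_linearr u').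
rewrite /tassoc tliftE ?tliftE //; split=> [w'|t c w1 w2].
  exact: tlift_linear.
elim/tensor_ind: t => [u' v'|t1 t2 h1 h2].
  by rewrite !tliftE // (tmul_linearr v') (tmul_linearr u').
have D (w' : W) (f := fun (u : U) (v : V) => u \ox (v \ox w')) :
    tlift f (t1 + t2) = tlift f t1 + tlift f t2.
  by have := tlift_linear (inner w') 1 t1 t2; rewrite !scale1r.
by rewrite !D h1 h2 scalerDr addrACA.
Qed.

End TensorMaps.

Section TensorAlgebra.
Variables (k : fieldType) (A B : algType k).

Definition tensor_one : A ⊗ B := 1 \ox 1.

Definition tensor_mul (t u : A ⊗ B) : A ⊗ B :=
  tlift (fun (a : A) (b : B) => tlift (fun (a' : A) (b' : B) =>
    (a * a') \ox (b * b')) u) t.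

Let inner a b : bilinear_map (fun (a' : A) (b' : B) => (a * a') \ox (b * b')).
Proof.
split=> [b' c a1 a2|a' c b1 b2]; rewrite mulrDr -scalerAr.
  exact: (tmul_linearl (b * b')).
exact: tmul_linearr.
Qed.

Let innerD (a : A) (b : B) (u1 u2 : A ⊗ B)
    (f := fun (a' : A) (b' : B) => (a * a') \ox (b * b')) :
  tlift f (u1 + u2) = tlift f u1 + tlift f u2.
Proof. by have := tlift_linear (inner a b) 1 u1 u2; rewrite !scale1r. Qed.

Let outer (u : A ⊗ B) :
  bilinear_map (fun (a : A) (b : B) =>
    tlift (fun (a' : A) (b' : B) => (a * a') \ox (b * b')) u).
Proof.
split=> [b c a1 a2|a c b1 b2]; elim/tensor_ind: u => [a' b'|u1 u2 h1 h2].
- rewrite !tliftE // mulrDl -scalerAl; exact: (tmul_linearl (b * b')).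
- by rewrite !innerD h1 h2 scalerDr addrACA.
- rewrite !tliftE // mulrDl -scalerAl; exact: tmul_linearr.
- by rewrite !innerD h1 h2 scalerDr addrACA.
Qed.

Lemma tensor_mulE a b a' b' :
  tensor_mul (a \ox b) (a' \ox b') = (a * a') \ox (b * b').
Proof. by rewrite /tensor_mul !tliftE. Qed.

Fact tensor_mulDl : left_distributive tensor_mul +%R.
Proof.
by move=> t1 t2 u; have := tlift_linear (outer u) 1 t1 t2; rewrite !scale1r.
Qed.

Fact tensor_mulDr : right_distributive tensor_mul +%R.
Proof.
move=> t u1 u2; elim/tensor_ind: t => [a b|t1 t2 h1 h2].
  by rewrite /tensor_mul !(tliftE (outer _)) innerD.
by rewrite !tensor_mulDl h1 h2 addrACA.
Qed.

Fact tensor_mulA : associative tensor_mul.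
Proof.
move=> t u v; elim/tensor_ind: t => [a b|t1 t2 h1 h2]; last first.
  by rewrite !tensor_mulDl h1 h2.
elim/tensor_ind: u => [a' b'|u1 u2 h1 h2]; last first.
  by rewrite !(tensor_mulDl, tensor_mulDr) h1 h2.
elim/tensor_ind: v => [a'' b''|v1 v2 h1 h2]; last first.
  by rewrite !tensor_mulDr h1 h2.
by rewrite !tensor_mulE !mulrA.
Qed.

Fact tensor_mul1 : left_id tensor_one tensor_mul.
Proof.
move=> t; elim/tensor_ind: t => [a b|t u ht hu]; last by rewrite tensor_mulDr ht hu.
by rewrite tensor_mulE !mul1r.
Qed.

Fact tensor_mulr1 : right_id tensor_one tensor_mul.
Proof.
move=> t; elim/tensor_ind: t => [a b|t u ht hu]; last by rewrite tensor_mulDl ht hu.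
by rewrite tensor_mulE !mulr1.
Qed.

HB.instance Definition _ := GRing.Zmodule_isPzRing.Build (A ⊗ B)%type
  tensor_mulA tensor_mul1 tensor_mulr1 tensor_mulDl tensor_mulDr.

Lemma mul_tmul (a a' : A) (b b' : B) :
  (a \ox b) * (a' \ox b') = (a * a') \ox (b * b').
Proof. exact: tensor_mulE. Qed.

End TensorAlgebra.

Record hopfAlgebra (k : fieldType) := HopfAlgebra {
  hopf_sort :> algType k;
  comul : {linear hopf_sort -> hopf_sort ⊗ hopf_sort};
  counit : {linear hopf_sort -> k^o};
  antipode : {linear hopf_sort -> hopf_sort};
  comul_coassoc : forall h,
    tassoc (tmap comul idfun (comul h)) = tmap idfun comul (comul h);
  counit_comull : forall h, tmap counit idfun (comul h) = (1 : k^o) \ox h;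
  counit_comulr : forall h, tmap idfun counit (comul h) = h \ox (1 : k^o);
  comul_monoid_morphism : monoid_morphism comul;
  counit_monoid_morphism : monoid_morphism counit;
  antipodel : forall h, tlift (fun a b => antipode a * b) (comul h) = (counit h)%:A;
  antipoder : forall h, tlift (fun a b => a * antipode b) (comul h) = (counit h)%:A }.

Section Comodules.
Variables (k : fieldType) (H : hopfAlgebra k).

Record comodule (N : lmodType k) := Comodule {
  coact :> {linear N -> N ⊗ H};
  coact_coassoc : forall n,
    tassoc (tmap coact idfun (coact n)) = tmap idfun (@comul k H) (coact n);
  coact_counit : forall n, tmap idfun (@counit k H) (coact n) = n \ox (1 : k^o) }.

Definition comodule_morphism (N L : lmodType k) (rhoN : comodule N)
    (rhoL : comodule L) (g : {linear N -> L}) : Prop :=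
  forall n, rhoL (g n) = tmap g idfun (rhoN n).

Record comoduleAlgebra (B : algType k) := ComoduleAlgebra {
  comodule_of :> comodule B;
  coact_monoid_morphism : monoid_morphism comodule_of }.

Section Galois.
Variables (B : algType k) (rho : comoduleAlgebra B).

Definition coinvariants : set B := [set b | rho b = b \ox 1].

(* B (x)_C B for a subset C of B, which acts by multiplication. *)
Definition self_tensor (C : set B) : Type :=
  tens (fun (b : B) (c : C) => b * val c) (fun (c : C) (b : B) => val c * b).

HB.instance Definition _ C := GRing.Zmodule.on (self_tensor C).

(* a (x) b |-> a b_(0) (x) b_(1) *)
Definition galois_map (C : set B) : self_tensor C -> B ⊗ H :=
  tens_lift (fun a b => tmap ( *%R a) idfun (rho b)).

Let mulmap_bilinear (a : B) :
  bilinear_map (fun (b : B) (h : H) => (a * b) \ox h).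
Proof.
split=> [h c b b'|b c h h']; last exact: tmul_linearr.
by rewrite mulrDr -scalerAr; apply: (tmul_linearl h).
Qed.

Lemma galois_map_balanced (C : set B) : (C `<=` coinvariants)%classic ->
  balanced (fun (b : B) (c : C) => b * val c) (fun (c : C) (b : B) => val c * b)
    (fun a b => tmap ( *%R a) idfun (rho b)).
Proof.
move=> sC; have mD (a : B) (t u : B ⊗ H) : tmap ( *%R a) idfun (t + u) =
    tmap ( *%R a) idfun t + tmap ( *%R a) idfun u.
  by have := tlift_linear (mulmap_bilinear a) 1 t u; rewrite !scale1r.
split=> [a a' b|a b b'|a c b]; [|by rewrite raddfD mD|].
  elim/tensor_ind: (rho b) => [b' h|t u ht hu]; last by rewrite !mD ht hu addrACA.
  by rewrite /tmap !(tliftE (mulmap_bilinear _)) mulrDl tmulDl.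
have /= rho_c := sC _ (set_valP c).
rewrite (coact_monoid_morphism rho).2 rho_c.
elim/tensor_ind: (rho b) => [b' h|t u ht hu]; last by rewrite mulrDr !mD ht hu.
by rewrite mul_tmul mul1r /tmap !(tliftE (mulmap_bilinear _)) mulrA.
Qed.

Lemma galois_mapE (C : set B) : (C `<=` coinvariants)%classic -> forall a b,
  galois_map (pure _ _ a b : self_tensor C) = tmap ( *%R a) idfun (rho b).
Proof. by move=> /galois_map_balanced gP a b; apply: tens_lift_pure. Qed.

Definition galois_extension (C : set B) : Prop :=
  coinvariants = C /\ bijective (@galois_map C).

Definition galois_object : Prop := galois_extension (range (in_alg B)).

End Galois.
End Comodules.

Section SkewPolynomials.
Variables (k : fieldType) (R A : algType k) (sigma : {lrmorphism R -> R}).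
Variables (iota : {lrmorphism R -> A}) (x : A).

(* {poly R} only serves as the type of finitely supported families (r_i) of
   elements of R; its multiplication plays no role here. *)
Definition skew_sum (r : {poly R}) : A := \sum_(i < size r) iota r`_i * x ^+ i.

(* The pair (iota, x) presents A as R[x; sigma]; bijectivity of skew_sum means
   that the powers of x form a basis of A as a left R-module. *)
Record skew_polynomial_ring : Prop := SkewPolynomialRing {
  skew_inj : injective iota;
  skew_basis : bijective skew_sum;
  skew_comm : forall r, x * iota r = iota (sigma r) * x }.

Definition base_polynomials : set A :=
  range (fun c : {poly k} => \sum_(i < size c) c`_i *: x ^+ i).

End SkewPolynomials.

(* Main.v *)
Require Import Defs.
From HB Require Import structures.
From mathcomp Require Import all_boot all_algebra.
From mathcomp Require Import boolp classical_sets.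

Import GRing.Theory.
Local Open Scope ring_scope.

(** The coinvariants are found coefficientwise: the k-linear coefficient maps
    pi_j : A -> R satisfy (pi_j (x) id) rho_A(sum_i r_i x^i) = rho_R(r_j), so a
    sum is coinvariant exactly when each r_j is coinvariant in R, that is, a
    scalar ([coinvariants_skew]).

    For the bijectivity of beta_A, let g be the inverse of beta_R and let
    Phi : R (x)_k R -> A (x)_k[x;sigma] A be induced by iota. The inverse of
    beta_A is gamma(a (x) h) = a Phi(g(1 (x) h)), that is, a times the
    translation map of R. That beta_A gamma is the identity is left linearity of
    beta_A. For the other composite, take 1 (x) r x^i, whose image is the sum
    of r_(0) x^i (x) r_(1); one must move x^i to the right of
    Phi(g(1 (x) r_(1))), and after that g beta_R = id in R finishes. The
    move costs an application of (sigma (x) sigma)^i inside Phi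
    ([tens_lmul_var]), and sigma (x) sigma fixes g(1 (x) h): as sigma is
    colinear and unital, beta_R sends both elements to 1 (x) h. The argument
    is carried out in [galois_map_skew_bijective]. *)

(** * Tensoring a linear map with the identity *)

Lemma zmod_morphismD (U V : zmodType) (f : U -> V) :
  zmod_morphism f -> {morph f : t u / t + u}.
Proof.
move=> fB t u; have f0 : f 0 = 0 by rewrite -(subrr 0) fB subrr.
by rewrite -[u in LHS]opprK fB -[- u]sub0r fB f0 sub0r opprK.
Qed.

Section TensorMapLeft.
Set Implicit Arguments.
Unset Strict Implicit.
Variable k : fieldType.

Lemma tmap_idr_bilinear (V V' W : lmodType k) (f : V -> V') : linear f ->
  bilinear_map (fun (v : V) (w : W) => f v \ox w).
Proof.
by move=> fL; split=> [w c v v'|v c w w'];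
  rewrite ?fL; [exact: tmul_linearl | exact: tmul_linearr].
Qed.

Lemma tmap_idrE (V V' W : lmodType k) (f : V -> V') : linear f ->
  forall (v : V) (w : W), tmap f idfun (v \ox w) = f v \ox w.
Proof. by move=> fL v w; apply: tliftE; apply: tmap_idr_bilinear. Qed.

Lemma tmap_idr_linear (V V' W : lmodType k) (f : V -> V') : linear f ->
  linear (tmap f (@idfun W)).
Proof. by move=> fL; apply: tlift_linear; apply: tmap_idr_bilinear. Qed.

Lemma tmap_idrD (V V' W : lmodType k) (f : V -> V') : linear f ->
  {morph tmap f (@idfun W) : t u / t + u}.
Proof.
by move=> fL t u; have := @tmap_idr_linear V V' W f fL 1 t u; rewrite !scale1r.
Qed.

Lemma tmap_idr0 (V V' W : lmodType k) (f : V -> V') : linear f ->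
  tmap f (@idfun W) 0 = 0.
Proof.
by move=> fL; apply: (addIr (tmap f idfun 0)); rewrite -tmap_idrD // !add0r.
Qed.

Lemma tmap_idr_sum (V V' W : lmodType k) (f : V -> V') : linear f ->
  forall n (F : 'I_n -> tensor V W),
  tmap f idfun (\sum_i F i) = \sum_i tmap f idfun (F i).
Proof.
move=> fL n F; apply: (big_morph (tmap f idfun)); first exact: tmap_idrD.
exact: tmap_idr0.
Qed.

Lemma tmap_idr_comp (V V' V'' W : lmodType k) (f : V -> V') (g : V' -> V'')
    (h : V -> V'') :
  linear f -> linear g -> linear h -> (forall v, g (f v) = h v) ->
  forall t : tensor V W, tmap g idfun (tmap f idfun t) = tmap h idfun t.
Proof.
move=> fL gL hL ghf t; elim/tensor_ind: t => [v w|t u ht hu].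
  by rewrite !tmap_idrE // ghf.
by rewrite !tmap_idrD // ht hu.
Qed.

Lemma tmap_id (V W : lmodType k) (t : tensor V W) : tmap idfun idfun t = t.
Proof.
have L : linear (@idfun V) by [].
elim/tensor_ind: t => [v w|t u ht hu]; first by rewrite tmap_idrE.
by rewrite tmap_idrD // ht hu.
Qed.

End TensorMapLeft.

(** * Maps between balanced tensor squares *)

Section SelfTensorMap.
Set Implicit Arguments.
Unset Strict Implicit.
Variables (k : fieldType) (B D : algType k) (C : set B) (E : set D).
Variables f g : B -> D.

Definition self_tensor_map : self_tensor C -> self_tensor E :=
  tens_lift (fun a b => pure _ _ (f a) (g b) : self_tensor E).

Hypotheses (fD : {morph f : a b / a + b}) (gD : {morph g : a b / a + b}).
(* Compatibility of (f, g) with the balancing. The element e may depend on c in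
   any way, so that no map from C to E has to be supplied. *)
Hypothesis fgC : forall c, C c -> exists2 e, E e &
  (forall a, f (a * c) = f a * e) /\ (forall b, g (c * b) = e * g b).

Lemma self_tensor_map_balanced :
  balanced (fun (b : B) (c : C) => b * val c) (fun (c : C) (b : B) => val c * b)
    (fun a b => pure _ _ (f a) (g b) : self_tensor E).
Proof.
split=> [a a' b|a b b'|a c b]; first by rewrite fD pureDl.
  by rewrite gD pureDr.
have [e Ee [fe ge]] := fgC (set_valP c).
by rewrite fe ge; apply: (pure_bal _ _ (f a) (SigSub (mem_set Ee)) (g b)).
Qed.

Lemma self_tensor_mapE a b :
  self_tensor_map (pure _ _ a b) = pure _ _ (f a) (g b).
Proof. exact: tens_lift_pure self_tensor_map_balanced a b. Qed.

Lemma self_tensor_mapD : {morph self_tensor_map : t u / t + u}.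
Proof. exact: zmod_morphismD (tens_liftB self_tensor_map_balanced). Qed.

End SelfTensorMap.
Arguments self_tensor_map {k B D C E}.

(** * Left linearity of the Galois map *)

Section GaloisMapMorphism.
Set Implicit Arguments.
Unset Strict Implicit.
Variables (k : fieldType) (H : hopfAlgebra k) (B : algType k).

Lemma mulr_linear_in (a : B) : linear ( *%R a).
Proof. by move=> c b b'; rewrite mulrDr scalerAr. Qed.

Variables (rho : comoduleAlgebra H B) (C : set B).
Hypothesis sC : (C `<=` coinvariants rho)%classic.

Lemma galois_mapD : {morph galois_map rho (C := C) : t u / t + u}.
Proof. exact: zmod_morphismD (tens_liftB (galois_map_balanced sC)). Qed.

Definition tens_lmul (a : B) : self_tensor C -> self_tensor C :=
  self_tensor_map ( *%R a) id.

Lemma tens_lmulE a b c : tens_lmul a (pure _ _ b c) = pure _ _ (a * b) c.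
Proof.
apply: self_tensor_mapE => // [b1 b2|d Cd]; first exact: mulrDr.
by exists d => //; split=> // ?; rewrite mulrA.
Qed.

Lemma tens_lmulD a : {morph tens_lmul a : t u / t + u}.
Proof.
apply: self_tensor_mapD => // [b1 b2|d Cd]; first exact: mulrDr.
by exists d => //; split=> // ?; rewrite mulrA.
Qed.

Lemma tens_lmulM a b t : tens_lmul a (tens_lmul b t) = tens_lmul (a * b) t.
Proof.
elim/tens_ind: t => [c d|t u ht hu]; first by rewrite !tens_lmulE mulrA.
by rewrite !tens_lmulD ht hu.
Qed.

Lemma tens_lmulDl a b t : tens_lmul (a + b) t = tens_lmul a t + tens_lmul b t.
Proof.
elim/tens_ind: t => [c d|t u ht hu]; first by rewrite !tens_lmulE mulrDl pureDl.
by rewrite !tens_lmulD ht hu addrACA.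
Qed.

Lemma galois_map_lmul a t :
  galois_map rho (tens_lmul a t) = tmap ( *%R a) idfun (galois_map rho t).
Proof.
have mL := mulr_linear_in.
elim/tens_ind: t => [b c|t u ht hu]; last first.
  by rewrite !(tens_lmulD, galois_mapD, tmap_idrD) ?ht ?hu.
rewrite tens_lmulE !galois_mapE // (tmap_idr_comp (h := *%R (a * b))) //.
by move=> v; rewrite mulrA.
Qed.

End GaloisMapMorphism.

(** * Coefficients and coinvariants of the skew polynomial ring *)

Section SkewCoefficients.
Set Implicit Arguments.
Unset Strict Implicit.
Variables (k : fieldType) (R A : algType k) (sigma : {lrmorphism R -> R}).
Variables (iota : {lrmorphism R -> A}) (x : A).

Lemma skew_monomial_linear j : linear (fun r : R => iota r * x ^+ j).
Proof. by move=> c r s; rewrite linearP mulrDl scalerAl. Qed.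

Lemma skew_sum_widen (p : {poly R}) n : (size p <= n)%N ->
  skew_sum iota x p = \sum_(i < n) iota p`_i * x ^+ i.
Proof.
move=> le_pn; rewrite /skew_sum.
rewrite (big_ord_widen n (fun i => iota p`_i * x ^+ i)) //.
rewrite big_mkcond; apply: eq_bigr => i _; case: ltnP => // le_pi.
by rewrite nth_default // raddf0 mul0r.
Qed.

(** {poly R} is an R-module and A a k-module, so the scalar c of k appears as
    c%:A on the side of {poly R}. *)
Lemma skew_sum_linear c (p q : {poly R}) :
  skew_sum iota x (c%:A *: p + q) = c *: skew_sum iota x p + skew_sum iota x q.
Proof.
pose n := maxn (size (c%:A *: p + q)) (maxn (size p) (size q)).
have [n1 n2 n3] : [/\ size (c%:A *: p + q)%R <= n, size p <= n & size q <= n]%N.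
  by rewrite /n !leq_max !leqnn !orbT.
rewrite (skew_sum_widen n1) (skew_sum_widen n2) (skew_sum_widen n3).
rewrite scaler_sumr -big_split; apply: eq_bigr => i _ /=.
by rewrite coefD coefZ mulr_algl skew_monomial_linear.
Qed.

Lemma skew_sum_monomial r j : skew_sum iota x (r *: 'X^j) = iota r * x ^+ j.
Proof.
have le_j : (size (r *: 'X^j : {poly R}) <= j.+1)%N.
  by apply: (leq_trans (size_scale_leq _ _)); rewrite size_polyXn.
rewrite (skew_sum_widen le_j) big_ord_recr big1 => [|i _] /=.
  by rewrite add0r coefZ coefXn eqxx mulr1.
by rewrite coefZ coefXn (ltn_eqF (ltn_ord i)) mulr0 raddf0 mul0r.
Qed.

Hypothesis A_skew : skew_polynomial_ring sigma iota x.

Lemma skew_sum_surj a : exists p, a = skew_sum iota x p.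
Proof. by have [q _ qK] := skew_basis A_skew; exists (q a). Qed.

Lemma skew_ind (P : A -> Prop) :
  (forall r i, P (iota r * x ^+ i)) -> (forall a b, P a -> P b -> P (a + b)) ->
  forall a, P a.
Proof.
move=> Pm PD a; have [p ->] := skew_sum_surj a.
apply: (big_ind P) => [|//|i _]; last exact: Pm.
rewrite -(mul0r (x ^+ 0)) -(raddf0 iota); exact: Pm.
Qed.

(** The inverse of [skew_sum] followed by the j-th coefficient; only its
    k-linearity is claimed, which is what tensoring with H over k needs. *)
Lemma skew_coefficient j : exists pi : A -> R,
  linear pi /\ forall p, pi (skew_sum iota x p) = p`_j.
Proof.
have [q pK qK] := skew_basis A_skew; exists (fun a => (q a)`_j).
split=> [c a b|p]; last by rewrite pK.
by rewrite -{1}(qK a) -{1}(qK b) -skew_sum_linear pK coefD coefZ mulr_algl.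
Qed.

Lemma base_polynomials_x : base_polynomials x x.
Proof.
exists 'X => //; rewrite size_polyX !big_ord_recr big_ord0 /= !coefX /=.
by rewrite scale0r scale1r !add0r.
Qed.

Lemma base_polynomials_scalar c : base_polynomials x c%:A.
Proof.
exists c%:P => //; rewrite size_polyC; have [->|_] /= := eqVneq c 0.
  by rewrite big_ord0 scale0r.
by rewrite big_ord_recr big_ord0 /= coefC eqxx add0r.
Qed.

Variables (H : hopfAlgebra k) (rhoR : comoduleAlgebra H R).
Variable rhoA : comoduleAlgebra H A.
Hypothesis rhoA_def : forall r : {poly R},
  rhoA (skew_sum iota x r) =
  \sum_(i < size r) tmap (fun s : R => iota s * x ^+ i) idfun (rhoR r`_i).

Lemma coact_skew_monomial r j :
  rhoA (iota r * x ^+ j) = tmap (fun s => iota s * x ^+ j) idfun (rhoR r).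
Proof.
have L := skew_monomial_linear.
rewrite -skew_sum_monomial rhoA_def; have [->|r0] := eqVneq r 0.
  by rewrite scale0r size_poly0 big_ord0 linear0 tmap_idr0.
have -> : size (r *: 'X^j : {poly R}) = j.+1.
  apply/eqP; rewrite eqn_leq (leq_trans (size_scale_leq _ _)) ?size_polyXn //=.
  by rewrite leqNgt; apply/negP => /leq_sizeP/(_ j (leqnn j))/eqP;
    rewrite coefZ coefXn eqxx mulr1 (negPf r0).
rewrite big_ord_recr big1 => [|i _] /=.
  by rewrite add0r coefZ coefXn eqxx mulr1.
by rewrite coefZ coefXn (ltn_eqF (ltn_ord i)) mulr0 linear0 tmap_idr0.
Qed.

Lemma coact_skew_var j : rhoA (x ^+ j) = x ^+ j \ox 1.
Proof.
rewrite -[x ^+ j]mul1r -(rmorph1 iota) coact_skew_monomial.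
rewrite (coact_monoid_morphism rhoR).1 tmap_idrE //.
exact: skew_monomial_linear.
Qed.

(** Apply pi_j (x) id to rho(a) = a (x) 1, where pi_j is the j-th coefficient:
    the left side becomes rho_R(p_j) and the right side p_j (x) 1. *)
Lemma coinvariants_skew_coef p j :
  coinvariants rhoA (skew_sum iota x p) -> coinvariants rhoR p`_j.
Proof.
have [pi [piL piE]] := skew_coefficient j.
have L := skew_monomial_linear.
move=> /(congr1 (tmap pi idfun)); rewrite tmap_idrE // piE rhoA_def.
rewrite tmap_idr_sum // /coinvariants /= => <-.
have pi_mono i r : pi (iota r * x ^+ i) = if i == j then r else 0.
  rewrite -skew_sum_monomial piE coefZ coefXn eq_sym.
  by case: eqP; rewrite ?mulr1 ?mulr0.
have pi_term i (t : R ⊗ H) :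
    tmap pi idfun (tmap (fun s => iota s * x ^+ i) idfun t) =
    if i == j then t else 0.
  elim/tensor_ind: t => [v w|t u ht hu].
    rewrite !tmap_idrE // pi_mono; case: eqP => // _; exact: pure0l.
  by rewrite !tmap_idrD // ht hu; case: eqP; rewrite ?addr0.
rewrite (eq_bigr (fun i : 'I_(size p) =>
    if i == j :> nat then rhoR p`_i else 0));
  last by move=> i _; rewrite pi_term.
case: (ltnP j (size p)) => [lt_j|le_j].
  rewrite (bigD1 (Ordinal lt_j)) //= eqxx big1 ?addr0 // => i.
  by rewrite -val_eqE /= => /negPf ->.
rewrite nth_default // linear0 big1 // => i _.
by rewrite (ltn_eqF (leq_trans (ltn_ord i) le_j)).
Qed.

Lemma coinvariants_skew :
  coinvariants rhoR = range (in_alg R) ->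
  coinvariants rhoA = base_polynomials x.
Proof.
move=> coR; apply/seteqP; split=> [a|_ [c _ <-]]; last first.
  rewrite /coinvariants /= linear_sum.
  rewrite (big_morph (fun a : A => a \ox (1 : H))
    (fun a b => tmulDl a b 1) (pure0l _ _ _)).
  by apply: eq_bigr => i _; rewrite linearZ /= coact_skew_var scale_tmul.
have [p ->] := skew_sum_surj a => /coinvariants_skew_coef co_p.
have /choice[c cE] : forall j, exists c : k, c%:A = p`_j.
  by move=> j; have := co_p j; rewrite coR => -[c _ <-]; exists c.
exists (\poly_(i < size p) c i) => //.
set q := \poly_(i < _) _.
have -> : \sum_(i < size q) q`_i *: x ^+ i = \sum_(i < size p) q`_i *: x ^+ i.
  rewrite (big_ord_widen (size p) (fun i => q`_i *: x ^+ i)) ?size_poly //.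
  rewrite big_mkcond; apply: eq_bigr => i _; case: ltnP => // le_i.
  by rewrite nth_default // scale0r.
apply: eq_bigr => i _; rewrite coef_poly ltn_ord -cE.
by rewrite rmorph_alg mulr_algl.
Qed.

End SkewCoefficients.

(** * Bijectivity of the Galois map of the skew polynomial ring *)

Section SkewGalois.
Set Implicit Arguments.
Unset Strict Implicit.
Variables (k : fieldType) (H : hopfAlgebra k).
Variables (R : algType k) (rhoR : comoduleAlgebra H R).
Variable sigma : {lrmorphism R -> R}.
Hypothesis sigma_comod : comodule_morphism rhoR rhoR sigma.
Variables (A : algType k) (iota : {lrmorphism R -> A}) (x : A).
Hypothesis A_skew : skew_polynomial_ring sigma iota x.
Variable rhoA : comoduleAlgebra H A.
Hypothesis rhoA_def : forall r : {poly R},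
  rhoA (skew_sum iota x r) =
  \sum_(i < size r) tmap (fun s : R => iota s * x ^+ i) idfun (rhoR r`_i).
Hypothesis coR : coinvariants rhoR = range (in_alg R).

Local Notation RR := (self_tensor (range (in_alg R))).
Local Notation AA := (self_tensor (base_polynomials x)).

Let sR : (range (in_alg R) `<=` coinvariants rhoR)%classic.
Proof. by rewrite coR. Qed.

Let sA : (base_polynomials x `<=` coinvariants rhoA)%classic.
Proof. by rewrite (coinvariants_skew A_skew rhoA_def coR). Qed.

(** The map called Phi above. *)
Definition iota_tens : RR -> AA := self_tensor_map iota iota.

Let iota_scalars c : range (in_alg R) c -> exists2 e, base_polynomials x e &
  (forall a, iota (a * c) = iota a * e) /\
  (forall b, iota (c * b) = e * iota b).
Proof.
case=> d _ <-; exists d%:A; first exact: base_polynomials_scalar.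
have iotaE : iota d%:A = d%:A by exact: rmorph_alg.
by split=> b; rewrite -iotaE; apply: rmorphM.
Qed.

Lemma iota_tensE a b : iota_tens (pure _ _ a b) = pure _ _ (iota a) (iota b).
Proof. by apply: self_tensor_mapE => //; apply: raddfD. Qed.

Lemma iota_tensD : {morph iota_tens : t u / t + u}.
Proof. by apply: self_tensor_mapD => //; apply: raddfD. Qed.

Lemma iota_tens_lmul r t :
  iota_tens (tens_lmul r t) = tens_lmul (iota r) (iota_tens t).
Proof.
elim/tens_ind: t => [a b|t u ht hu].
  by rewrite tens_lmulE !iota_tensE tens_lmulE rmorphM.
by rewrite !(tens_lmulD, iota_tensD) ht hu.
Qed.

Lemma galois_map_iota t :
  galois_map rhoA (iota_tens t) = tmap iota idfun (galois_map rhoR t).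
Proof.
have iL : linear iota by exact: linearP.
have [mR mA] := (@mulr_linear_in k R, @mulr_linear_in k A).
elim/tens_ind: t => [a b|t u ht hu]; last first.
  rewrite iota_tensD (galois_mapD sR) (galois_mapD sA) tmap_idrD // ht hu //.
rewrite iota_tensE !galois_mapE //.
rewrite -[iota b]mulr1 -(expr0 x) (coact_skew_monomial rhoA_def).
have L : linear (fun r : R => iota (a * r)).
  by move=> c r s; rewrite mulrDr -scalerAr linearP.
have L0 := skew_monomial_linear iota x 0.
rewrite [RHS](tmap_idr_comp (h := fun r : R => iota (a * r))) //.
apply: tmap_idr_comp => // r; rewrite expr0 mulr1; exact/esym/rmorphM.
Qed.

Definition sigma_tens : RR -> RR := self_tensor_map sigma sigma.

Let sigma_scalars c : range (in_alg R) c -> exists2 e, range (in_alg R) e &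
  (forall a, sigma (a * c) = sigma a * e) /\
  (forall b, sigma (c * b) = e * sigma b).
Proof.
case=> d _ <-; exists (sigma d%:A).
  by exists d => //; apply/esym/rmorph_alg.
by split=> b; apply: rmorphM.
Qed.

Lemma sigma_tensE a b :
  sigma_tens (pure _ _ a b) = pure _ _ (sigma a) (sigma b).
Proof. by apply: self_tensor_mapE => //; apply: raddfD. Qed.

Lemma sigma_tensD : {morph sigma_tens : t u / t + u}.
Proof. by apply: self_tensor_mapD => //; apply: raddfD. Qed.

(** Colinearity of sigma: sigma(a) sigma(b)_(0) (x) sigma(b)_(1)
    = sigma(a b_(0)) (x) b_(1). *)
Lemma galois_map_sigma t :
  galois_map rhoR (sigma_tens t) = tmap sigma idfun (galois_map rhoR t).
Proof.
have iL : linear sigma by exact: linearP.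
have mR := @mulr_linear_in k R.
elim/tens_ind: t => [a b|t u ht hu]; last first.
  by rewrite sigma_tensD !(galois_mapD sR) tmap_idrD // ht hu.
rewrite sigma_tensE !galois_mapE // sigma_comod.
have L : linear (fun r : R => sigma (a * r)).
  by move=> c r s; rewrite mulrDr -scalerAr linearP.
rewrite [RHS](tmap_idr_comp (h := fun r : R => sigma (a * r))) //.
apply: tmap_idr_comp => // r; exact/esym/rmorphM.
Qed.

Definition tens_rmulX n : AA -> AA := self_tensor_map id ( *%R^~ (x ^+ n)).

Lemma tens_rmulXE n a b : tens_rmulX n (pure _ _ a b) = pure _ _ a (b * x ^+ n).
Proof.
apply: self_tensor_mapE => // [b1 b2|d Cd]; first exact: mulrDl.
by exists d => //; split=> // ?; rewrite mulrA.
Qed.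

Lemma tens_rmulXD n : {morph tens_rmulX n : t u / t + u}.
Proof.
apply: self_tensor_mapD => // [b1 b2|d Cd]; first exact: mulrDl.
by exists d => //; split=> // ?; rewrite mulrA.
Qed.

Lemma tens_rmulX0 t : tens_rmulX 0 t = t.
Proof.
elim/tens_ind: t => [a b|t u ht hu]; first by rewrite tens_rmulXE mulr1.
by rewrite tens_rmulXD ht hu.
Qed.

Lemma tens_rmulXS n t : tens_rmulX n.+1 t = tens_rmulX 1 (tens_rmulX n t).
Proof.
elim/tens_ind: t => [a b|t u ht hu].
  by rewrite !tens_rmulXE exprSr mulrA expr1.
by rewrite !tens_rmulXD ht hu.
Qed.

Lemma tens_lmul_rmulX n a t :
  tens_lmul a (tens_rmulX n t) = tens_rmulX n (tens_lmul a t).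
Proof.
elim/tens_ind: t => [b c|t u ht hu].
  by rewrite !(tens_lmulE, tens_rmulXE).
by rewrite !(tens_lmulD, tens_rmulXD) ht hu.
Qed.

(** Since x belongs to the coinvariants, x a (x) b = sigma(a) x (x) b
    = sigma(a) (x) x b = sigma(a) (x) sigma(b) x for all a, b in R. *)
Lemma tens_lmul_var t :
  tens_lmul x (iota_tens t) = tens_rmulX 1 (iota_tens (sigma_tens t)).
Proof.
elim/tens_ind: t => [a b|t u ht hu]; last first.
  by rewrite !(sigma_tensD, iota_tensD, tens_lmulD, tens_rmulXD) ht hu.
rewrite sigma_tensE !iota_tensE tens_lmulE tens_rmulXE (skew_comm A_skew) expr1.
rewrite -[in RHS](skew_comm A_skew).
exact: (pure_bal _ _ (iota (sigma a)) (SigSub (mem_set (base_polynomials_x x)))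
  (iota b)).
Qed.

Lemma tens_lmul_varX n t : sigma_tens t = t ->
  tens_lmul (x ^+ n) (iota_tens t) = tens_rmulX n (iota_tens t).
Proof.
move=> st; elim: n => [|n IH].
  rewrite tens_rmulX0; elim/tens_ind: (iota_tens t) => [a b|u v hu hv].
    by rewrite tens_lmulE mul1r.
  by rewrite tens_lmulD hu hv.
by rewrite exprSr -tens_lmulM tens_lmul_var st tens_lmul_rmulX IH -tens_rmulXS.
Qed.

(** The two-sided inverse is gamma(a (x) h) = a Phi(g(1 (x) h)), with g the
    inverse of the Galois map of R. The identity gamma_monomial, that
    gamma(s x^i (x) h) = Phi(g(s (x) h)) x^i, is where powers of x are moved
    across the translation map. *)
Lemma galois_map_skew_bijective :
  bijective (galois_map rhoR (C := range (in_alg R))) ->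
  bijective (galois_map rhoA (C := base_polynomials x)).
Proof.
case=> g gK Kg; have gI := can_inj gK.
have [mR mA] := (@mulr_linear_in k R, @mulr_linear_in k A).
have gD : {morph g : t u / t + u}.
  by move=> t u; apply: gI; rewrite (galois_mapD sR) !Kg.
have g_mul r h : g (r \ox h) = tens_lmul r (g (1 \ox h)).
  by apply: gI; rewrite galois_map_lmul // !Kg tmap_idrE // mulr1.
have g_sigma h : sigma_tens (g (1 \ox h)) = g (1 \ox h).
  apply: gI; rewrite galois_map_sigma !Kg tmap_idrE ?rmorph1 //.
  exact: linearP.
pose f (a : A) (h : H) : AA := tens_lmul a (iota_tens (g (1 \ox h))).
have fP : balanced (fun (a : A) (c : k) => c *: a) (fun c (h : H) => c *: h) f.
  split=> [a a' h|a h h'|a c h]; rewrite /f.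
  - exact: tens_lmulDl.
  - by rewrite tmulDr gD iota_tensD tens_lmulD.
  - rewrite -tmulZ [in RHS]g_mul iota_tens_lmul tens_lmulM.
    congr (tens_lmul _ _).
    rewrite -[a in LHS]mulr1 scalerAr; congr (_ * _).
    exact/esym/rmorph_alg.
pose gamma : A ⊗ H -> AA := tlift f.
have gammaE a h : gamma (a \ox h) = f a h by exact: tens_lift_pure fP a h.
have gammaD : {morph gamma : t u / t + u}.
  exact: zmod_morphismD (tens_liftB fP).
have gamma_monomial i (t : R ⊗ H) :
    gamma (tmap (fun s => iota s * x ^+ i) idfun t) =
    tens_rmulX i (iota_tens (g t)).
  have L := skew_monomial_linear iota x i.
  elim/tensor_ind: t => [r h|t u ht hu]; last first.
    by rewrite tmap_idrD // gammaD ht hu gD iota_tensD tens_rmulXD.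
  rewrite tmap_idrE // gammaE /f -tens_lmulM tens_lmul_varX //.
  by rewrite tens_lmul_rmulX g_mul iota_tens_lmul.
have gamma_mul a t : gamma (tmap ( *%R a) idfun t) = tens_lmul a (gamma t).
  elim/tensor_ind: t => [b h|t u ht hu].
    by rewrite tmap_idrE // !gammaE /f tens_lmulM.
  by rewrite tmap_idrD // !gammaD tens_lmulD ht hu.
exists gamma => [t|t].
  elim/tens_ind: t => [a b|t u ht hu]; last first.
    by rewrite (galois_mapD sA) gammaD ht hu.
  elim/(skew_ind A_skew): b => [r i|b c hb hc]; last first.
    by rewrite pureDr (galois_mapD sA) gammaD hb hc.
  rewrite galois_mapE // gamma_mul (coact_skew_monomial rhoA_def).
  rewrite gamma_monomial.
  have -> : rhoR r = galois_map rhoR (pure _ _ 1 r : RR).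
    by rewrite galois_mapE // (_ : *%R 1 = id) ?tmap_id //; apply/funext/mul1r.
  by rewrite gK iota_tensE tens_rmulXE tens_lmulE rmorph1 mulr1.
elim/tensor_ind: t => [a h|t u ht hu].
  rewrite gammaE galois_map_lmul // galois_map_iota Kg.
  have iL : linear iota by exact: linearP.
  by rewrite !tmap_idrE // rmorph1 mulr1.
by rewrite gammaD (galois_mapD sA) ht hu.
Qed.

End SkewGalois.

Theorem theoremt15 (k : fieldType) (H : hopfAlgebra k)
    (R : algType k) (rhoR : comoduleAlgebra H R)
    (sigma : {lrmorphism R -> R})
    (sigma_inj : injective sigma)
    (sigma_comod : comodule_morphism rhoR rhoR sigma)
    (A : algType k) (iota : {lrmorphism R -> A}) (x : A)
    (A_skew : skew_polynomial_ring sigma iota x)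
    (rhoA : comoduleAlgebra H A)
    (rhoA_def : forall r : {poly R},
       rhoA (skew_sum iota x r) =
       \sum_(i < size r) tmap (fun s : R => iota s * x ^+ i) idfun (rhoR r`_i)) :
  galois_object rhoR ->
  galois_extension rhoA (base_polynomials x).
Proof.
case=> coR bijR; have coA := coinvariants_skew A_skew rhoA_def coR.
split=> //.
exact: (galois_map_skew_bijective sigma_comod A_skew rhoA_def coR bijR).
Qed.
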